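(* Let $R$ be a commutative unital topological ring, $G$ a small category, $s : G \to \mathrm{Top}^{\mathrm{op}}$ a functor, and for each $e \in \mathrm{ob}(G)$ let $A_e$ be a subring of the ring $C(s(e),R)$ of continuous maps $s(e)\to R$ such that $\sigma(n)(f) := f\circ s(n) \in A_{c(n)}$ for every morphism $n$ of $G$ and every $f \in A_{d(n)}$. Let $A = \bigoplus_{e\in\mathrm{ob}(G)} A_e$ and let $A\rtimes^{\sigma}G$ be the associated skew category algebra. Consider the following three assertions: (i) $s$ is topologically free; (ii) if $I$ is a nonzero (two-sided) ideal of $A \rtimes^{\sigma} G$, then $I\cap A\neq\{0\}$; (iii) $A$ is maximal commutative in $A\rtimes^{\sigma}G$. Then: (a) (ii) implies (iii); (b) if $G$ is a groupoid, then (ii) holds if and only if (iii) holds; (c) if $R$ is an integral domain and for each $e\in \mathrm{ob}(G)$ the function space $A_e$ separates elements of $s(e)$ and for each $f\in A_e$ the set $f^{-1}(\{0\})$ is closed in $s(e)$, then (i) implies (iii) (the condition that the sets $f^{-1}(\{0\})$ are closed holds e.g. if $\{0\}$ is closed in $R$, which, in turn, holds e.g. when $R$ is Hausdorff); (d) if $R$ is an integral domain and for each $e \in\mathrm{ob}(G)$ the space $s(e)$ is Hausdorff and Baire, the function space $A_e$ separates elements of $s(e)$ and has the property that for each nonempty open subset $U$ of $s(e)$ there is a nonzero $f\in A_e$ that vanishes on $s(e)\setminus U$, then (iii) implies (i).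
   Context: For a morphism $n$ of $G$, $d(n)$ and $c(n)$ denote its domain and codomain; objects are identified with their identity morphisms; $mn$ is defined when $d(m)=c(n)$. A groupoid is a category in which all morphisms are isomorphisms. $\mathrm{Top}$ is the category of topological spaces and continuous maps. A functor $s : G \to \mathrm{Top}^{\mathrm{op}}$ assigns to each object $e$ a space $s(e)$ and to each morphism $n$ a continuous map $s(n) : s(c(n)) \to s(d(n))$, with $s(mn) = s(n)\circ s(m)$ and $s(e)=\mathrm{id}_{s(e)}$ for identities. A topological ring is a ring with a topology for which addition and multiplication are continuous maps $R\times R\to R$. A subring is a subset that is itself a ring under the given operations. Topologically free: $x \in s(e)$ is periodic if there is a nonidentity morphism $n : e \to e$ with $s(n)(x)=x$, and aperiodic otherwise; $s$ is topologically free if for every $e\in\mathrm{ob}(G)$ the set of aperiodic elements of $s(e)$ is dense in $s(e)$. $A_e$ separates elements of $s(e)$ if for all distinct $x,y\in s(e)$ there is $f\in A_e$ with $f(x)\neq f(y)$. The triple $(A,G,\sigma)$ is a skew category system; by definition of this notion, each $A_e$ is a unital ring (with nonzero identity) and $\sigma$ is a functor from $G$ to the category of unital rings and identity-preserving ring homomorphisms, with $\sigma(n):A_{d(n)}\to A_{c(n)}$. The skew category algebra $A \rtimes^{\sigma} G$ is the set of formal sums $\sum_{n\in G} a_n u_n$ over morphisms $n$ of $G$, with $a_n \in A_{c(n)}$ and $a_n = 0$ for all but finitely many $n$, with componentwise addition and multiplication $$\Big(\sum_{n} a_n u_n\Big)\Big(\sum_{n} b_n u_n\Big) = \sum_{n}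 \Big(\sum_{mm'=n,\ d(m)=c(m')} a_m\,\sigma(m)(b_{m'})\Big) u_n .$$ $A$ is regarded as a subring via $\sum_e a_e \mapsto \sum_{e} a_e u_e$. A commutative subring is maximal commutative if it equals its commutant (the set of elements of the big ring commuting with all its elements).
   Formalization: In (d) it is additionally assumed that for each object e the set of morphisms e → e is countable; without this (d) fails, e.g. for all affine maps x ↦ ax+b acting on the real line with A = C(ℝ,ℝ), where (iii) holds but every point is periodic. *)

(* Defs.v *)
From HB Require Import structures.
From mathcomp Require Import all_boot all_order all_algebra.
From mathcomp Require Import all_classical.
From mathcomp Require Import topology.
From Stdlib Require Import Eqdep.

Set Implicit Arguments.
Unset Strict Implicit.
Unset Printing Implicit Defensive.

Import GRing.Theory.
Local Open Scope classical_set_scope.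
Local Open Scope ring_scope.

HB.mixin Record PreTopologicalComPzRing_isTopological R
    & Topological R & GRing.ComPzRing R := {
  top_add_continuous : continuous (fun x : R * R => x.1 + x.2) ;
  top_mul_continuous : continuous (fun x : R * R => x.1 * x.2) }.

#[short(type="topologicalComPzRingType")]
HB.structure Definition TopologicalComPzRing :=
  {R of Topological R & GRing.ComPzRing R
      & PreTopologicalComPzRing_isTopological R}.

Definition integral_domain (R : comPzRingType) : Prop :=
  (1 : R) <> 0 /\ forall x y : R, x * y = 0 -> x = 0 \/ y = 0.

Definition baire_space (X : topologicalType) : Prop :=
  forall U : nat -> set X, (forall k, open (U k) /\ dense (U k)) ->
    dense (\bigcap_k U k).

(* [compm m n] is the product mn, defined when the domain of m is the codomain
   of n. *)
Record category := Category {
  obj : Type ;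
  mor : obj -> obj -> Type ;
  idm : forall e, mor e e ;
  compm : forall e1 e2 e3, mor e2 e3 -> mor e1 e2 -> mor e1 e3 ;
  comp_idl : forall e1 e2 (n : mor e1 e2), compm (idm e2) n = n ;
  comp_idr : forall e1 e2 (n : mor e1 e2), compm n (idm e1) = n ;
  compA : forall e1 e2 e3 e4 (n1 : mor e3 e4) (n2 : mor e2 e3) (n3 : mor e1 e2),
    compm n1 (compm n2 n3) = compm (compm n1 n2) n3 }.

Arguments mor : clear implicits.
Arguments idm {c}.
Arguments compm {c e1 e2 e3}.

Definition groupoid (G : category) : Prop :=
  forall (e1 e2 : obj G) (n : mor G e1 e2),
    exists m : mor G e2 e1, compm m n = idm e1 /\ compm n m = idm e2.

Record morphism (G : category) :=
  Mor { dom : obj G ; cod : obj G ; arrow : mor G dom cod }.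

Record top_functor (G : category) := TopFunctor {
  top_space : obj G -> topologicalType ;
  smap : forall e1 e2, mor G e1 e2 -> top_space e2 -> top_space e1 ;
  smap_continuous : forall e1 e2 (n : mor G e1 e2), continuous (smap n) ;
  smap_id : forall e, smap (idm e) =1 id ;
  smap_comp : forall e1 e2 e3 (m : mor G e2 e3) (n : mor G e1 e2),
    smap (compm m n) =1 smap n \o smap m }.

Arguments smap {G} t {e1 e2} n x.

Definition periodic (G : category) (s : top_functor G) (e : obj G)
    (x : top_space s e) : Prop :=
  exists n : mor G e e, n <> idm e /\ smap s n x = x.

Definition topologically_free (G : category) (s : top_functor G) : Prop :=
  forall e : obj G, dense [set x : top_space s e | ~ periodic x].

(* Subsets of S that are unital rings with nonzero identity under the
   operations of S; the identity need not be that of S. *)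
Record unital_subring (S : pzRingType) := UnitalSubring {
  subring_set :> S -> Prop ;
  subring_one : S ;
  subring0 : subring_set 0 ;
  subringB : forall f g, subring_set f -> subring_set g -> subring_set (f - g) ;
  subringM : forall f g, subring_set f -> subring_set g -> subring_set (f * g) ;
  subring1 : subring_set subring_one ;
  subring_mul1 : forall f, subring_set f -> subring_one * f = f ;
  subring_mulr1 : forall f, subring_set f -> f * subring_one = f ;
  subring1_neq0 : subring_one <> 0 }.

Section SubringType.
Variables (S : pzRingType) (B : unital_subring S).

Definition subring_pred : {pred S} := fun f => `[< B f >].

Fact subring_pred_zmod : zmod_closed subring_pred.
Proof.
split=> [|f g /asboolP Bf /asboolP Bg]; apply/asboolP; first exact: subring0.
exact: subringB.
Qed.

HB.instance Definition _ :=
  GRing.isZmodClosed.Build S subring_pred subring_pred_zmod.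

Record subring_type := SubringElt {
  subring_val :> S ;
  subring_valP : subring_val \in subring_pred }.

HB.instance Definition _ := [isSub for subring_val].
HB.instance Definition _ := [Choice of subring_type by <:].
HB.instance Definition _ := [SubChoice_isSubZmodule of subring_type by <:].

Definition subring_elt (f : S) (Bf : B f) : subring_type :=
  SubringElt (introT (asboolP (B f)) Bf).

Lemma subring_eltP (f : subring_type) : B f.
Proof. by apply/asboolP; apply: subring_valP. Qed.

Let one : subring_type := subring_elt (subring1 B).
Let mul (f g : subring_type) : subring_type :=
  subring_elt (subringM (subring_eltP f) (subring_eltP g)).

Let mulA : associative mul.
Proof. by move=> f g h; apply: val_inj; rewrite /= mulrA. Qed.
Let mul1 : left_id one mul.
Proof. by move=> f; apply: val_inj; apply/subring_mul1/subring_eltP. Qed.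
Let mulr1 : right_id one mul.
Proof. by move=> f; apply: val_inj; apply/subring_mulr1/subring_eltP. Qed.
Let mulDl : left_distributive mul +%R.
Proof. by move=> f g h; apply: val_inj; rewrite /= mulrDl. Qed.
Let mulDr : right_distributive mul +%R.
Proof. by move=> f g h; apply: val_inj; rewrite /= mulrDr. Qed.
Let one_neq0 : one != 0.
Proof. by apply/eqP => /(congr1 val); apply: subring1_neq0. Qed.

HB.instance Definition _ := GRing.Zmodule_isNzRing.Build subring_type
  mulA mul1 mulr1 mulDl mulDr one_neq0.

End SubringType.

(* Bundled ring morphisms preserve 1. *)
Record skew_system (G : category) := SkewSystem {
  coeff_ring :> obj G -> nzRingType ;
  skew_act : forall e1 e2,
    mor G e1 e2 -> {rmorphism coeff_ring e1 -> coeff_ring e2} ;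
  act_id : forall e, skew_act (idm e) =1 id ;
  act_comp : forall e1 e2 e3 (m : mor G e2 e3) (n : mor G e1 e2),
    skew_act (compm m n) =1 skew_act m \o skew_act n }.

Arguments skew_act {G} s {e1 e2} n.

Section SkewAlgebra.
Variables (G : category) (S : skew_system G).

(* The formal sum of the terms (coef n) u_n. *)
Record skew_algebra := SkewSum {
  coef : forall n : morphism G, S (cod n) ;
  coef_finite : finite_set [set n | coef n <> 0] }.

Lemma skew_algebraP (a b : skew_algebra) : a = b <-> forall n, coef a n = coef b n.
Proof.
split=> [-> //|]; case: a b => [a fa] [b fb] /= eq_ab.
have E : a = b by apply: functional_extensionality_dep.
by case: _ / E fb => fb; rewrite (Prop_irrelevance fa fb).
Qed.

HB.instance Definition _ := gen_eqMixin skew_algebra.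
HB.instance Definition _ := gen_choiceMixin skew_algebra.

Fact skew0_finite :
  finite_set [set n : morphism G | (0 : S (cod n)) <> 0].
Proof. by apply: (sub_finite_set _ (finite_set0 _)) => n /=; apply. Qed.

Fact skew_opp_finite (a : skew_algebra) :
  finite_set [set n | - coef a n <> 0].
Proof.
apply: sub_finite_set (coef_finite a) => n /= an0 a0.
by apply: an0; rewrite a0 oppr0.
Qed.

Fact skew_add_finite (a b : skew_algebra) :
  finite_set [set n | coef a n + coef b n <> 0].
Proof.
have fab : finite_set ([set n | coef a n <> 0] `|` [set n | coef b n <> 0]).
  by rewrite finite_setU; split; apply: coef_finite.
apply: sub_finite_set fab => n /= abn0.
have [a0|/eqP an0] := eqVneq (coef a n) 0; last by left.
by right => b0; apply: abn0; rewrite a0 b0 addr0.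
Qed.

Let zero := SkewSum skew0_finite.
Let opp a := SkewSum (skew_opp_finite a).
Let add a b := SkewSum (skew_add_finite a b).

Let addA : associative add.
Proof. by move=> a b c; apply/skew_algebraP => n /=; rewrite addrA. Qed.
Let addC : commutative add.
Proof. by move=> a b; apply/skew_algebraP => n /=; rewrite addrC. Qed.
Let add0 : left_id zero add.
Proof. by move=> a; apply/skew_algebraP => n /=; rewrite add0r. Qed.
Let addN : left_inverse zero opp add.
Proof. by move=> a; apply/skew_algebraP => n /=; rewrite addNr. Qed.

HB.instance Definition _ :=
  GRing.isZmodule.Build skew_algebra addA addC add0 addN.

(* Composable pairs (m, m') with domain of m' equal to that of n and codomain
   of m equal to that of n. *)
Definition pairs (n : morphism G) : Type :=
  {e : obj G & mor G e (cod n) * mor G (dom n) e}%type.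

Definition factorizations (n : morphism G) : set {classic pairs n} :=
  [set p | compm (projT2 p).1 (projT2 p).2 = arrow n].
Arguments factorizations : clear implicits.

Definition skew_term (a b : skew_algebra) (n : morphism G) (p : pairs n) :
    S (cod n) :=
  coef a (Mor (projT2 p).1) * skew_act S (projT2 p).1 (coef b (Mor (projT2 p).2)).
Arguments skew_term : clear implicits.

(* The sum has finitely many nonzero terms, see [skew_term_finite]. *)
Definition skew_mul_coef (a b : skew_algebra) (n : morphism G) : S (cod n) :=
  \sum_(p \in factorizations n) skew_term a b n p.

Lemma pairs_inj (n : morphism G) (p q : pairs n) :
  Mor (projT2 p).1 = Mor (projT2 q).1 ->
  Mor (projT2 p).2 = Mor (projT2 q).2 -> p = q.
Proof.
case: p q => [e [m m']] [f [k k']] /= mk mk'.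
have ef : e = f by exact: (congr1 (@dom G) mk).
case: _ / ef k k' mk mk' => k k' mk mk'.
pose tag (m0 : morphism G) : {x : obj G & {y : obj G & mor G x y}} :=
  existT _ (dom m0) (existT _ (cod m0) (arrow m0)).
have -> : m = k by exact: inj_pair2 (inj_pair2 _ _ _ _ _ (congr1 tag mk)).
by have -> : m' = k' by exact: inj_pair2 (inj_pair2 _ _ _ _ _ (congr1 tag mk')).
Qed.

Lemma skew_term_finite (a b : skew_algebra) (n : morphism G) :
  finite_set [set p : {classic pairs n} | skew_term a b n p <> 0].
Proof.
pose f (p : {classic pairs n}) := (Mor (projT2 p).1, Mor (projT2 p).2).
have ff := finite_setX (coef_finite a) (coef_finite b).
apply: sub_finite_set (finite_preimage (f := f) _ ff) => [p /= pn0|p q _ _ pq].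
  split=> /= [a0|b0]; apply: pn0; first by rewrite /skew_term a0 mul0r.
  by rewrite /skew_term b0 raddf0 mulr0.
exact: pairs_inj (congr1 fst pq) (congr1 snd pq).
Qed.

Fact skew_mul_finite (a b : skew_algebra) :
  finite_set [set n | skew_mul_coef a b n <> 0].
Proof.
pose f (q : morphism G * morphism G) : morphism G :=
  if pselect (cod q.2 = dom q.1) is left E
  then Mor (compm (arrow q.1) (ecast x (mor G (dom q.2) x) E (arrow q.2)))
  else q.1.
have ff := finite_setX (coef_finite a) (coef_finite b).
apply: sub_finite_set (finite_image f ff) => n /= abn0.
have [[p pn p0]|none] := pselect (exists2 p, factorizations n p &
    skew_term a b n p <> 0); last first.
  case: abn0; apply: fsbig1 => p pn.
  by apply: contrapT => p0; apply: none; exists p.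
exists (Mor (projT2 p).1, Mor (projT2 p).2) => /=.
  split=> /= [a0|b0]; apply: p0; first by rewrite /skew_term a0 mul0r.
  by rewrite /skew_term b0 raddf0 mulr0.
rewrite /f /=; case: pselect => // E.
by rewrite (Prop_irrelevance E erefl) /= pn; case: (n).
Qed.

Definition skew_mul (a b : skew_algebra) : skew_algebra :=
  SkewSum (skew_mul_finite a b).

(* The image of the direct sum of the coefficient rings. *)
Definition base_ring : set skew_algebra :=
  [set a | forall n, coef a n <> 0 -> exists e, n = Mor (idm e)].

Definition two_sided_ideal (I : set skew_algebra) : Prop :=
  [/\ I 0, forall a b, I a -> I b -> I (a - b),
      forall a b, I b -> I (skew_mul a b)
    & forall a b, I a -> I (skew_mul a b)].

Definition commutant (B : set skew_algebra) : set skew_algebra :=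
  [set a | forall b, B b -> skew_mul a b = skew_mul b a].

Definition maximal_commutative (B : set skew_algebra) : Prop :=
  B = commutant B.

Definition ideal_intersection_property : Prop :=
  forall I : set skew_algebra, two_sided_ideal I -> I <> [set 0] ->
    I `&` base_ring <> [set 0].

End SkewAlgebra.

Arguments factorizations {G} n _.
Arguments skew_term {G S} a b n p.
Arguments base_ring {G} S _.
Arguments ideal_intersection_property {G} S.

Section FunctionSystem.
Variables (R : comPzRingType) (G : category) (s : top_functor G).
Variable A : forall e : obj G, unital_subring (top_space s e -> R).
Hypothesis A_act : forall e1 e2 (n : mor G e1 e2) f,
  A e1 f -> A e2 (f \o smap s n).
Hypothesis A_act1 : forall e1 e2 (n : mor G e1 e2),
  subring_one (A e1) \o smap s n = subring_one (A e2).

Definition fun_act e1 e2 (n : mor G e1 e2) (f : subring_type (A e1)) :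
  subring_type (A e2) := subring_elt (A_act n (subring_eltP f)).

Fact fun_act_zmod e1 e2 (n : mor G e1 e2) : zmod_morphism (fun_act n).
Proof. by move=> f g; apply: val_inj. Qed.

Fact fun_act_monoid e1 e2 (n : mor G e1 e2) : monoid_morphism (fun_act n).
Proof.
by split=> [|f g]; apply: val_inj; first exact: A_act1.
Qed.

HB.instance Definition _ e1 e2 (n : mor G e1 e2) :=
  GRing.isZmodMorphism.Build _ _ (fun_act n) (fun_act_zmod n).
HB.instance Definition _ e1 e2 (n : mor G e1 e2) :=
  GRing.isMonoidMorphism.Build _ _ (fun_act n) (fun_act_monoid n).

Fact fun_act_id e : fun_act (idm e) =1 id.
Proof.
by move=> f; apply: val_inj; apply/funext => x /=; rewrite smap_id.
Qed.

Fact fun_act_comp e1 e2 e3 (m : mor G e2 e3) (n : mor G e1 e2) :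
  fun_act (compm m n) =1 fun_act m \o fun_act n.
Proof.
by move=> f; apply: val_inj; apply/funext => x /=; rewrite smap_comp.
Qed.

Definition function_system : skew_system G :=
  @SkewSystem G (fun e => subring_type (A e))
    (fun e1 e2 (n : mor G e1 e2) => fun_act n)
    fun_act_id fun_act_comp.

End FunctionSystem.

Definition separates (X Y : Type) (B : set (X -> Y)) : Prop :=
  forall x y : X, x <> y -> exists2 f, B f & f x <> f y.

(* Main.v *)
Require Import Defs.
From mathcomp Require Import all_boot all_order all_algebra.
From mathcomp Require Import all_classical.
From mathcomp Require Import topology.
From Stdlib Require Import Eqdep.

(* Commuting with A means: a_n = 0 unless n is an endomorphism of some e, and
   a_n (sigma(n)(f) - f) = 0 for all f in A_e.  So A is maximal commutative iff
   no nonidentity n : e -> e has a nonzero a in A_e with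
   a (sigma(n)(f) - f) = 0 for all f.
   (a) The algebra acts on the product of the A_e; the annihilator of this
   module is an ideal meeting A trivially, and it contains a u_n - a u_e for
   every a and n violating the criterion.
   (b) Right translation by u_(m^-1) moves a nonzero term a_m u_m of x in I to
   an identity without enlarging the support; a commutator of the result with
   an element of A then has strictly smaller support.
   (c), (d) Since A_e separates points and R is a domain, the criterion says
   that no nonzero a in A_e vanishes off the fixed points of s(n); the aperiodic
   points are the intersection over n of the complements of these fixed point
   sets. *)

Set Implicit Arguments.
Unset Strict Implicit.
Unset Printing Implicit Defensive.

Import GRing.Theory.
Local Open Scope classical_set_scope.
Local Open Scope ring_scope.

(** * Sums of finite support, and equality of bundled morphisms *)

Lemma fsbig_fibers (V : nmodType) (I J : choiceType) (h : I -> J) (F : I -> V) :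
  finite_set [set i | F i <> 0] ->
  \sum_(i \in [set: I]) F i =
  \sum_(j \in [set: J]) \sum_(i \in h @^-1` [set j]) F i.
Proof.
set D := [set i | _] => finD.
have zeroD i : ~ D i -> F i = 0 by move=> /contrapT.
transitivity (\sum_(i \in D) F i).
  by apply/esym/fsbig_widen => // i [_ /zeroD].
(* Each [F i] is spread over the image of [D] with an indicator of [h i = j]; both index sets are
   now finite, so the sums can be exchanged. *)
transitivity (\sum_(i \in D) \sum_(j \in h @` D)
    if i \in h @^-1` [set j] then F i else 0).
  apply: eq_fsbigr => i /set_mem Di.
  rewrite -(@fsbig_widen _ _ _ _ [set h i]).
  - by rewrite fsbig_set1 ifT// inE.
  - by move=> _ ->; exists i.
  - by move=> j [_ jhi] /=; case: ifPn => //; rewrite inE /= => hij; case: jhi.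
rewrite exchange_fsbig //; last exact: finite_image.
transitivity (\sum_(j \in h @` D) \sum_(i \in h @^-1` [set j]) F i).
  apply: eq_fsbigr => j _; rewrite -fsbig_mkcondr.
  by apply: fsbig_widen => [i []//|i [hij] nDi]; apply: zeroD => Di; apply: nDi.
apply: fsbig_widen => // j [_ nj]; apply: fsbig1 => i hij.
by apply: zeroD => Di; apply: nj; exists i.
Qed.

Lemma fsbig_morph (U V : nmodType) (f : U -> V) (I : choiceType) (P : set I)
    (F : I -> U) :
  {morph f : x y / x + y} -> f 0 = 0 -> finite_set [set i | F i <> 0] ->
  f (\sum_(i \in P) F i) = \sum_(i \in P) f (F i).
Proof.
move=> fD f0 finF; rewrite fsbig_supp fsbig_finite; last first.
  by apply: sub_finite_set finF => i [].
rewrite (big_morph f fD f0) -fsbig_finite; last first.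
  by apply: sub_finite_set finF => i [].
apply: fsbig_widen => [i []//|i [Pi Fi]] /=.
have [-> //|/eqP nz] := eqVneq (F i) 0.
by case: Fi.
Qed.

(** The type of the arrow depends on both ends, so the equality is moved to nested dependent pairs,
    where [inj_pair2] strips the ends one at a time. *)
Lemma Mor_inj (G : category) (e1 e2 : obj G) : injective (@Mor G e1 e2).
Proof.
move=> m k E.
pose tag (m0 : morphism G) : {x : obj G & {y : obj G & mor G x y}} :=
  existT _ (dom m0) (existT _ (cod m0) (arrow m0)).
exact: inj_pair2 (inj_pair2 _ _ _ _ _ (congr1 tag E)).
Qed.

(** * Monomials, and products with elements of A *)

Section SkewAlgebra.
Variables (G : category) (S : skew_system G).
Implicit Types a b x y : skew_algebra S.

Lemma skew_mul_coef1 a b (n : morphism G) (p : pairs n) :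
  factorizations n p ->
  (forall q : pairs n, factorizations n q -> q <> p -> skew_term a b n q = 0) ->
  coef (skew_mul a b) n = skew_term a b n p.
Proof.
move=> pn other; rewrite /= /skew_mul_coef.
rewrite -(@fsbig_widen {classic pairs n} _ _ _ [set p]).
- by rewrite fsbig_set1.
- by move=> _ ->.
- by move=> q [qn qp]; apply: other.
Qed.

Lemma skew_mul_neq0 a b (n : morphism G) : coef (skew_mul a b) n <> 0 ->
  exists2 p : pairs n, factorizations n p & skew_term a b n p <> 0.
Proof.
move=> ab0; apply: contrapT => none; apply: ab0; apply: fsbig1 => p pn.
by apply: contrapT => p0; apply: none; exists p.
Qed.

Lemma skew_term_neq0 a b (n : morphism G) (p : pairs n) :
  skew_term a b n p <> 0 ->
  coef a (Mor (projT2 p).1) <> 0 /\ coef b (Mor (projT2 p).2) <> 0.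
Proof.
move=> p0; split=> [a0|b0]; apply: p0; first by rewrite /skew_term a0 mul0r.
by rewrite /skew_term b0 raddf0 mulr0.
Qed.

(** The coefficients of a u_n. The ring depends on [k], so [a] has to be transported along a proof
    of [n = k]. *)
Definition monomial_coef (n : morphism G) (a : S (cod n)) (k : morphism G) :
    S (cod k) :=
  if pselect (n = k) is left E then ecast k (S (cod k)) E a else 0.

Lemma monomial_coefE n (a : S (cod n)) : @monomial_coef n a n = a.
Proof.
rewrite /monomial_coef; case: pselect => // E.
by rewrite (Prop_irrelevance E erefl).
Qed.

Lemma monomial_coef0 n (a : S (cod n)) k : n <> k -> @monomial_coef n a k = 0.
Proof. by rewrite /monomial_coef; case: pselect. Qed.

Fact monomial_finite n (a : S (cod n)) :
  finite_set [set k | @monomial_coef n a k <> 0].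
Proof.
apply: (sub_finite_set _ (finite_set1 n)) => k /= nz.
by apply: contrapT => nk; apply: nz; rewrite monomial_coef0// => E; apply: nk.
Qed.

Definition monomial n (a : S (cod n)) := SkewSum (@monomial_finite n a).

Lemma monomial_base e (a : S e) : base_ring S (@monomial (Mor (idm e)) a).
Proof.
move=> k /= nz; exists e; apply: contrapT => nk; apply: nz.
by apply: monomial_coef0 => E; apply: nk.
Qed.

(** As [b] lives on identities, the only factorization of [n] that can contribute is n = n id. *)
Lemma coef_mul_base a b (n : morphism G) : base_ring S b ->
  coef (skew_mul a b) n =
  coef a n * skew_act S (arrow n) (coef b (Mor (idm (dom n)))).
Proof.
case: n => e1 e2 n Bb.
pose p : pairs (Mor n) := existT _ e1 (n, idm e1).
rewrite (@skew_mul_coef1 a b (Mor n) p) //; first exact: comp_idr.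
move=> q mk np; apply: contrapT => /skew_term_neq0[_ /Bb[e' E]].
case: q mk np E => e [m k]; rewrite /factorizations /= => mk np E.
have Ee : e = e' := congr1 (@cod G) E.
have Ee1 : e1 = e' := congr1 (@dom G) E.
subst e' e1; move/Mor_inj: E => E; subst k; apply: np; rewrite /p.
by rewrite comp_idr in mk; rewrite mk.
Qed.

Lemma coef_base_mul a b (n : morphism G) : base_ring S b ->
  coef (skew_mul b a) n = coef b (Mor (idm (cod n))) * coef a n.
Proof.
case: n => e1 e2 n Bb.
pose p : pairs (Mor n) := existT _ e2 (idm e2, n).
rewrite (@skew_mul_coef1 b a (Mor n) p).
- by rewrite /skew_term /= act_id.
- exact: comp_idl.
move=> q mk np; apply: contrapT => /skew_term_neq0[/Bb[e' E] _].
case: q mk np E => e [m k]; rewrite /factorizations /= => mk np E.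
have Ee : e = e' := congr1 (@dom G) E.
have Ee1 : e2 = e' := congr1 (@cod G) E.
subst e' e2; move/Mor_inj: E => E; subst m; apply: np; rewrite /p.
by rewrite comp_idl in mk; rewrite mk.
Qed.

(** * The coefficientwise criterion for maximal commutativity *)

Definition commutative_coeffs := forall (e : obj G) (f g : S e), f * g = g * f.

Lemma maximal_commutativeP : commutative_coeffs ->
  maximal_commutative (base_ring S) <->
  forall (e : obj G) (n : mor G e e) (a : S e), n <> idm e ->
    (forall f : S e, a * skew_act S n f = a * f) -> a = 0.
Proof.
move=> C; split=> [maxA e n a nid an|H].
  apply: contrapT => a0; apply: nid.
  (* The hypothesis on [a] says that a u_n commutes with A. By maximality it lies in A, so a nonzero
     [a] forces [n] to be an identity. *)
  have : base_ring S (@monomial (Mor n) a).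
    rewrite maxA => b Bb; apply/skew_algebraP => k.
    rewrite coef_mul_base// coef_base_mul//= [RHS]C.
    have [<-|nk] := pselect (Mor n = k); first by rewrite !monomial_coefE an.
    by rewrite !monomial_coef0// !mul0r.
  move=> /(_ (Mor n)) /=; rewrite monomial_coefE => /(_ a0)[e' E].
  have Ee : e = e' := congr1 (@dom G) E.
  by subst e'; move/Mor_inj: E.
apply/seteqP; split=> [a Ba b Bb|a comm_a [e1 e2 n] an0].
  apply/skew_algebraP => k; rewrite coef_mul_base// coef_base_mul// [RHS]C.
  have [->|/eqP /Ba[e ->]] := eqVneq (coef a k) 0; first by rewrite !mul0r.
  by rewrite /= act_id.
(* Compare coefficients at [n] in a u_(e2) = u_(e2) a: the right side gives a_n, the left side 0
   unless the ends of [n] agree. *)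
have Ee : e1 = e2.
  apply: contrapT => ne; apply: an0.
  have /skew_algebraP/(_ (Mor n)) := comm_a _ (@monomial_base e2 1).
  rewrite coef_mul_base ?coef_base_mul; try exact: monomial_base.
  rewrite /= monomial_coefE mul1r => <-.
  rewrite monomial_coef0 ?raddf0 ?mulr0// => E.
  by apply: ne; exact/esym/(congr1 (@dom G) E).
subst e2; exists e1; congr Mor; apply: contrapT => nid; apply: an0.
apply: (H e1 n) => // f.
have /skew_algebraP/(_ (Mor n)) := comm_a _ (@monomial_base e1 f).
rewrite coef_mul_base ?coef_base_mul; try exact: monomial_base.
by rewrite /= monomial_coefE => ->; apply: C.
Qed.


(** * The action on the product of the coefficient rings, and its annihilator *)

Definition arrows_to (c : obj G) : Type := {e : obj G & mor G e c}.

Definition act_term x (w : forall e, S e) c (q : arrows_to c) : S c :=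
  coef x (Mor (projT2 q)) * skew_act S (projT2 q) (w (projT1 q)).

(** The component at [c] of x w, where a u_m takes a family w to a sigma(m)(w_(d(m))), placed at
    c(m). *)
Definition module_act x (w : forall e, S e) (c : obj G) : S c :=
  \sum_(q \in [set: {classic arrows_to c}]) act_term x w q.

Definition arrow_to_mor c (q : {classic arrows_to c}) := Mor (projT2 q).

Lemma arrow_to_mor_inj c : injective (@arrow_to_mor c).
Proof.
move=> [e m] [f k]; rewrite /arrow_to_mor /= => E.
have ef : e = f := congr1 (@dom G) E.
by subst f; move/Mor_inj: E => ->.
Qed.

Lemma act_finite x c :
  finite_set [set q : {classic arrows_to c} | coef x (arrow_to_mor q) <> 0].
Proof.
apply: (finite_preimage (f := @arrow_to_mor c) _ (coef_finite x)) => p q _ _.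
exact: arrow_to_mor_inj.
Qed.

Lemma act_termB x y w c (q : arrows_to c) :
  act_term (x - y) w q = act_term x w q - act_term y w q.
Proof. exact: mulrBl. Qed.

Lemma module_actB x y w c :
  module_act (x - y) w c = module_act x w c - module_act y w c.
Proof.
pose D (z : skew_algebra S) :=
  [set q : {classic arrows_to c} | coef z (arrow_to_mor q) <> 0].
have finD : finite_set (D x `|` D y).
  by rewrite finite_setU; split; apply: act_finite.
(* All three sums are brought to one finite index set, the union of the two supports, where
   subtraction is termwise. *)
have on_D z : (forall q, D z q -> (D x `|` D y) q) ->
    module_act z w c = \sum_(q \in D x `|` D y) act_term z w q.
  move=> sub; apply/esym/fsbig_widen => // q [_ nDq] /=.
  by rewrite /act_term (contrapT (fun nz => nDq (sub q nz))) mul0r.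
rewrite !on_D; first last.
- move=> q; rewrite /D /= => nz.
  have [x0|/eqP] := eqVneq (coef x (arrow_to_mor q)) 0; last by left.
  by right=> y0; apply: nz; rewrite x0 y0 subr0.
- by left.
- by right.
by rewrite !fsbig_finite// -sumrB; apply: eq_bigr => q _; apply: act_termB.
Qed.

Definition arrow_paths (c : obj G) : Type :=
  {m : arrows_to c & arrows_to (projT1 m)}.

Definition path_comp c (t : {classic arrow_paths c}) : {classic arrows_to c} :=
  existT _ (projT1 (projT2 t)) (compm (projT2 (projT1 t)) (projT2 (projT2 t))).

Definition path_term x y w c (t : arrow_paths c) : S c :=
  let m := projT1 t in let k := projT2 t in
  coef x (Mor (projT2 m)) * skew_act S (projT2 m) (act_term y w k).

Lemma path_term_finite x y w c :
  finite_set [set t : {classic arrow_paths c} | path_term x y w t <> 0].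
Proof.
pose f (t : {classic arrow_paths c}) :=
  (Mor (projT2 (projT1 t)), Mor (projT2 (projT2 t))).
have ff := finite_setX (coef_finite x) (coef_finite y).
apply: sub_finite_set (finite_preimage (f := f) _ ff) => [t /= nz|].
  split=> /= [x0|y0]; apply: nz; rewrite /path_term ?x0 ?mul0r//.
  by rewrite /act_term y0 mul0r raddf0 mulr0.
move=> t t' _ _ E; have := congr1 snd E; have := congr1 fst E => /= {E}.
case: t t' => m k [m' k'] /= /arrow_to_mor_inj Em; subst m'.
by move/(@arrow_to_mor_inj (projT1 m)) => ->.
Qed.

(** Both sides sum [path_term] over the composable pairs (m, k) ending at [c]: the left side groups
    the pairs by the composite mk, the right side by the outer arrow m. *)
Lemma module_act_mul x y w c :
  module_act (skew_mul x y) w c = module_act x (module_act y w) c.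
Proof.
transitivity (\sum_(t \in [set: {classic arrow_paths c}]) path_term x y w t).
  rewrite (fsbig_fibers (@path_comp c) (@path_term_finite x y w c)).
  apply: eq_fsbigr => -[e k] _; rewrite /act_term /= /skew_mul_coef.
  rewrite (@fsbig_morph _ _ (fun z => z * skew_act S k (w e))); first last.
  - exact: skew_term_finite.
  - exact: mul0r.
  - by move=> z1 z2; apply: mulrDl.
  (* [g] identifies the factorizations of [k] with the fibre of [path_comp] over [k]. *)
  pose g (p : {classic pairs (Mor k)}) : {classic arrow_paths c} :=
    existT (fun m : arrows_to c => arrows_to (projT1 m))
      (existT _ (projT1 p) (projT2 p).1) (existT _ e (projT2 p).2).
  rewrite [RHS](@reindex_fsbig _ _ _ _ _ g (factorizations (Mor k))).
    apply: eq_fsbigr => -[f [m m']]; rewrite inE /factorizations /= => <-.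
    by rewrite /skew_term /path_term /act_term /= rmorphM act_comp mulrA.
  split.
  - by move=> [f [m m']]; rewrite /factorizations /path_comp /= => <-.
  - move=> p q _ _ E; apply: pairs_inj; first exact:
      (congr1 (fun t : arrow_paths c => Mor (projT2 (projT1 t))) E).
    exact: (congr1 (fun t : arrow_paths c => Mor (projT2 (projT2 t))) E).
  - move=> [[f m] [e' m']] /= E.
    have Ee : e' = e := congr1 (@projT1 _ _) E.
    subst e'; exists (existT _ f (m, m')) => //.
    by move/(congr1 (@arrow_to_mor c)): E; apply: Mor_inj.
pose first_arrow (t : {classic arrow_paths c}) : {classic arrows_to c} := projT1 t.
rewrite (fsbig_fibers first_arrow
  (@path_term_finite x y w c)).
apply: eq_fsbigr => m _; rewrite /act_term /=.
rewrite (@fsbig_morph _ _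
  (fun z => coef x (Mor (projT2 m)) * skew_act S (projT2 m) z)); first last.
- apply: sub_finite_set (act_finite y (projT1 m)) => q /= nz y0; apply: nz.
  by rewrite /act_term; move: y0; rewrite /arrow_to_mor => ->; rewrite mul0r.
- by rewrite raddf0 mulr0.
- by move=> z1 z2; rewrite raddfD mulrDr.
pose g (k : {classic arrows_to (projT1 m)}) : {classic arrow_paths c} :=
  existT (fun m : arrows_to c => arrows_to (projT1 m)) m k.
apply: (@reindex_fsbig _ _ _ _ _ g setT); split=> //.
- by move=> k k' _ _ /(@inj_pair2 _ _ _ _ _).
- by move=> [m' k] /= E; subst m'; exists k.
Qed.

Definition annihilator : set (skew_algebra S) :=
  [set x | forall w c, module_act x w c = 0].

Lemma module_act0 w c : module_act 0 w c = 0.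
Proof. by apply: fsbig1 => q _; rewrite /act_term mul0r. Qed.

Lemma module_actr0 x w c : (forall e, w e = 0) -> module_act x w c = 0.
Proof.
by move=> w0; apply: fsbig1 => q _; rewrite /act_term w0 raddf0 mulr0.
Qed.

(** Closure under products on either side follows from (xy)w = x(yw). *)
Lemma annihilator_ideal : two_sided_ideal annihilator.
Proof.
split=> [w c|x y Ix Iy w c|x y Iy w c|x y Ix w c].
- exact: module_act0.
- by rewrite module_actB Ix Iy subr0.
- by rewrite module_act_mul module_actr0// => e; apply: Iy.
- by rewrite module_act_mul.
Qed.

Lemma module_act1 x w c (q : arrows_to c) :
  (forall p : arrows_to c, coef x (Mor (projT2 p)) <> 0 -> p = q) ->
  module_act x w c = act_term x w q.
Proof.
move=> only_q; rewrite /module_act.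
rewrite -(@fsbig_widen {classic arrows_to c} _ _ _ [set q]) ?fsbig_set1//.
move=> p [_ /= pq]; rewrite /act_term.
by rewrite (contrapT (fun nz => pq (only_q p nz))) mul0r.
Qed.

Lemma monomial_neq0 n (a : S (cod n)) k : coef (monomial a) k <> 0 -> n = k.
Proof.
by move=> nz; apply: contrapT => nk; apply: nz; apply: monomial_coef0.
Qed.

Lemma module_act_monomial (e1 e2 : obj G) (n : mor G e1 e2) (a : S e2) w :
  module_act (@monomial (Mor n) a) w e2 = a * skew_act S n (w e1).
Proof.
rewrite (@module_act1 _ _ _ (existT _ e1 n)) => [|p /monomial_neq0 E].
  by rewrite /act_term /= monomial_coefE.
by apply: arrow_to_mor_inj; rewrite /arrow_to_mor -E.
Qed.

Lemma module_act_monomial0 (e1 e2 : obj G) (n : mor G e1 e2) (a : S e2) w c :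
  e2 <> c -> module_act (@monomial (Mor n) a) w c = 0.
Proof.
move=> ne; apply: fsbig1 => p _; rewrite /act_term /= monomial_coef0 ?mul0r//.
by move=> E; apply: ne; exact: (congr1 (@cod G) E).
Qed.

(** An element of A acts componentwise, so applying it to the family of identities 1 reads off its
    coefficients. *)
Lemma annihilator_base x : annihilator x -> base_ring S x -> x = 0.
Proof.
move=> Ix Bx; apply/skew_algebraP => n; apply: contrapT => nz.
have [c nE] := Bx _ nz; subst n; apply: nz.
rewrite /= -(Ix (fun e => 1) c) (@module_act1 _ _ _ 
  (existT (fun e => mor G e c) c (idm c))).
  by rewrite /act_term /= rmorph1 mulr1.
move=> [e m] nz; have [e' E] := Bx _ nz; have Ee : e = e' := congr1 (@dom G) E.
have Ec : c = e' := congr1 (@cod G) E.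
by subst e' e; move: E => /= /Mor_inj ->.
Qed.

(** * From the ideal intersection property to maximal commutativity *)

Lemma ideal_intersection_maximal :
  commutative_coeffs -> ideal_intersection_property S ->
  maximal_commutative (base_ring S).
Proof.
move=> C ii; apply/maximal_commutativeP => // e n a nid an.
apply: contrapT => a0.
(* By the assumption on [a], both monomials send w to a w_e at [e] and to 0 elsewhere. Yet [b] is
   nonzero: its coefficient at [n] is [a], since [n] is not the identity. *)
pose b := @monomial (Mor n) a - @monomial (Mor (idm e)) a.
have Ib : annihilator b.
  move=> w c; rewrite module_actB.
  have [<-|ne] := pselect (e = c); last first.
    by rewrite !module_act_monomial0// subr0.
  by rewrite !module_act_monomial act_id an subrr.
apply: (ii annihilator annihilator_ideal).
  move=> I0; move: Ib; rewrite I0 => /skew_algebraP/(_ (Mor n)) /=.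
  rewrite monomial_coefE monomial_coef0 ?subr0// => /Mor_inj E.
  by apply: nid.
apply/seteqP; split=> x /=; first by case=> /annihilator_base.
by move=> ->; split=> [|k //]; case: annihilator_ideal.
Qed.

(** * Groupoids: from maximal commutativity to ideal intersection *)

Lemma translate_support x (d c : obj G) (m : mor G c d)
    (u : S d) (l : seq {classic morphism G}) :
  (forall k, coef x k <> 0 -> (k : {classic morphism G}) \in l) ->
  exists l' : seq {classic morphism G}, (size l' <= size l)%N /\
    forall k, coef (skew_mul x (@monomial (Mor m) u)) k <> 0 ->
      (k : {classic morphism G}) \in l'.
Proof.
move=> suppx.
(* Support elements of the product have the form qm with q in the support of [x]. The value of [f]
   at a q not composable with [m] is a mere default. *)
pose f (q : {classic morphism G}) : {classic morphism G} :=
  if pselect (d = dom q) is left E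
  then Mor (compm (arrow q) (ecast e (mor G c e) E m)) else q.
exists (map f l); split=> [|[d' c' k]]; first by rewrite size_map.
move=> /skew_mul_neq0[p pk /skew_term_neq0[/suppx xl /monomial_neq0 E]].
apply/mapP; exists (Mor (projT2 p).1) => //.
case: p pk xl E => e' [q m']; rewrite /factorizations /= => pk xl E.
have Ec : c = d' := congr1 (@dom G) E; have Ed : d = e' := congr1 (@cod G) E.
subst d' e'; move/Mor_inj: E => E; rewrite /f; case: pselect => // E'.
by rewrite (Prop_irrelevance E' erefl) /= E pk.
Qed.

Lemma maximal_ideal_intersection :
  groupoid G -> commutative_coeffs -> maximal_commutative (base_ring S) ->
  ideal_intersection_property S.
Proof.
rewrite /ideal_intersection_property /= => gG C maxA I [I0 IB ILM IRM] Inz.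
suff [x [Ix Bx xnz]] : exists x, [/\ I x, base_ring S x & x <> 0].
  by move=> E; apply: xnz; have : (I `&` base_ring S) x by []; rewrite E.
have [x Ix xnz] : exists2 x, I x & x <> 0.
  apply: contrapT => none; apply: Inz; apply/seteqP; split=> x /=.
    by move=> Ix; apply: contrapT => xnz; apply: none; exists x.
  by move=> ->.
have [l suppx] : exists l : seq {classic morphism G},
    forall k, coef x k <> 0 -> (k : {classic morphism G}) \in l.
  have /(@finite_seqP {classic morphism G}) [l lE] := coef_finite x.
  exists l => k nz.
  by have : [set n | coef x n <> 0] k by []; rewrite lE.
(* Strong induction on the length of a list that contains the support; the list may be larger than
   the support. *)
have [N sl] := ubnP (size l); elim: N => // N IH in x Ix xnz l suppx sl *.
have [[d c m] xm] : exists m, coef x m <> 0.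
  apply: contrapT => none; apply: xnz; apply/skew_algebraP => k.
  by apply: contrapT => nz; apply: none; exists k.
have [m1 [m1m mm1]] := gG _ _ m.
(* With [m1] the inverse of [m], the coefficient of [y] at the identity of [c] is the nonzero x_m:
   if k m1 = id, cancelling [m1] gives k = m, so no other term contributes. *)
pose y := skew_mul x (@monomial (Mor m1) 1).
have Iy : I y by apply: IRM.
have yc : coef y (Mor (idm c)) <> 0.
  pose p : pairs (Mor (idm c)) := existT _ d (m, m1).
  rewrite (@skew_mul_coef1 _ _ _ p) //.
    by rewrite /skew_term /= monomial_coefE rmorph1 mulr1.
  move=> q qn qp; apply: contrapT => /skew_term_neq0[_ /monomial_neq0 E].
  case: q qn qp E => e [k k1]; rewrite /factorizations /= => kk1 qp E.
  have Ed : d = e := congr1 (@cod G) E; subst e; move/Mor_inj: E => E; subst k1.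
  apply: qp; suff -> : k = m by [].
  by rewrite -(comp_idr k) -m1m Defs.compA kk1 comp_idl.
have ynz : y <> 0 by move=> y0; apply: yc; rewrite y0.
have [l' [sl' suppy]] := translate_support m1 1 suppx.
(* Either [y] commutes with A and so lies in A by maximality, or some [b] in A yields a nonzero
   commutator, again in the ideal. *)
have [comm_y|/existsNP[b /not_implyP[Bb yb]]] :=
    pselect (commutant (base_ring S) y).
  by exists y; split=> //; rewrite maxA.
pose z := skew_mul y b - skew_mul b y.
have zE k : coef z k =
    coef y k * skew_act S (arrow k) (coef b (Mor (idm (dom k))))
    - coef b (Mor (idm (cod k))) * coef y k.
  by rewrite -coef_mul_base// -coef_base_mul.
(* The support of [z] lies in that of [y] and misses the identity of [c], where the coefficients
   commute. That identity does occur in [l'], so filtering it out shortens the list. *)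
apply: (IH z _ _ (seq.filter (predC1 (Mor (idm c) : {classic morphism G})) l')).
- by apply: IB; [apply: IRM|apply: ILM].
- by move/eqP; rewrite subr_eq0 => /eqP.
- move=> k zk; rewrite mem_filter; apply/andP; split.
    apply/eqP => kE; apply: zk; rewrite kE zE /= act_id.
    by rewrite [X in X - _]C subrr.
  apply: suppy => yk; apply: zk; rewrite zE.
  by have -> : coef y k = 0 by []; rewrite mul0r mulr0 subrr.
- apply: leq_trans (leq_trans sl' _); last by rewrite -ltnS.
  rewrite size_filter.
  rewrite -(count_predC (pred1 (Mor (idm c) : {classic morphism G})) l').
  rewrite -[X in (X < _)%N]add0n ltn_add2r -has_count has_pred1.
  exact: suppy.
Qed.

End SkewAlgebra.

(** * Function systems: topological freeness against maximal commutativity *)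

Lemma fixed_points_closed (X : topologicalType) (h : X -> X) :
  hausdorff_space X -> continuous h -> closed [set x | h x = x].
Proof.
(* Neighbourhoods of h(x) and x always meet: by continuity, a fixed point close enough to [x] lies
   in both. *)
move=> hX ch x clx; apply: hX => U V hxU xV.
have [y [hy [Uhy Vy]]] := clx _ (filterI (ch x U hxU : nbhs x (h @^-1` U)) xV).
by exists y; split=> //; rewrite -hy.
Qed.

Section FunctionSystem.
Variables (R : comPzRingType) (G : category) (s : top_functor G).
Variable A : forall e : obj G, unital_subring (top_space s e -> R).
Hypothesis A_act : forall e1 e2 (n : mor G e1 e2) f,
  A e1 f -> A e2 (f \o smap s n).
Hypothesis A_act1 : forall e1 e2 (n : mor G e1 e2),
  subring_one (A e1) \o smap s n = subring_one (A e2).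

Let S := function_system A_act A_act1.

Lemma function_system_commutative : commutative_coeffs S.
Proof. by move=> e f g; apply: val_inj; apply/funext => x; apply: mulrC. Qed.

Lemma function_system_maximalP :
  maximal_commutative (base_ring S) <->
  forall (e : obj G) (n : mor G e e) (f : top_space s e -> R),
    A e f -> n <> idm e ->
    (forall g, A e g -> forall x, f x * g (smap s n x) = f x * g x) -> f = 0.
Proof.
apply: iff_trans (maximal_commutativeP function_system_commutative) _.
split=> H e n f => [Af nid fn|nid fn].
  apply: (congr1 val (H e n (subring_elt Af) nid _)) => g.
  by apply: val_inj; apply/funext => x; apply: fn (subring_eltP g) x.
apply: val_inj; apply: (H e n) => // [|g Ag x]; first exact: subring_eltP.
by move/(congr1 (fun h : S e => val h x)): (fn (subring_elt Ag)).
Qed.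

Hypothesis domR : integral_domain R.

Lemma topologically_free_maximal :
  (forall e : obj G, separates (A e)) ->
  (forall e (f : top_space s e -> R), A e f -> closed (f @^-1` [set 0])) ->
  topologically_free s -> maximal_commutative (base_ring S).
Proof.
move=> sepA zeroA free; apply/function_system_maximalP => e n f Af nid fn.
apply: contrapT => f0.
(* Where [f] is nonzero is a nonempty open set, so it contains an aperiodic point. A function g
   separating that point from its image under s(n) then gives two nonzero factors with product 0. *)
have [x [fx0 aper]] : ~` (f @^-1` [set 0]) `&` [set x | ~ periodic x] !=set0.
  apply: free; last by apply: closed_openC; apply: zeroA.
  apply: contrapT => none; apply: f0; apply/funext => x; apply: contrapT => fx.
  by apply: none; exists x.
have nx : smap s n x <> x by move=> E; apply: aper; exists n.
have [g Ag gx] := sepA e _ _ nx.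
have : f x * (g (smap s n x) - g x) = 0 by rewrite mulrBr fn// subrr.
by case/domR.2 => [/fx0|/subr0_eq].
Qed.

Lemma maximal_topologically_free :
  (forall e : obj G, countable [set: mor G e e]) ->
  (forall e : obj G, hausdorff_space (top_space s e)) ->
  (forall e : obj G, baire_space (top_space s e)) ->
  (forall e (U : set (top_space s e)), open U -> U !=set0 ->
     exists f, [/\ A e f, f <> 0 & forall x, ~ U x -> f x = 0]) ->
  maximal_commutative (base_ring S) -> topologically_free s.
Proof.
move=> countG hX bX bump /function_system_maximalP maxA e.
have /countable_injP[num num_inj] := countG e.
(* The Baire property concerns sequences, so the complements of the fixed point sets are indexed by
   the codes [num n]. A [k] coding no nonidentity morphism gives the whole space. *)
pose M k := [set x : top_space s e |
  forall n, n <> idm e -> num n = k -> smap s n x <> x].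
have -> : [set x : top_space s e | ~ periodic x] = \bigcap_k M k.
  apply/seteqP; split=> x /= aper.
    by move=> k _ n nid _ nx; apply: aper; exists n.
  by move=> [n [nid nx]]; exact: (aper (num n) I n nid erefl).
apply: bX => k.
have [[n [nid nk]]|none] :=
    pselect (exists n, n <> idm e /\ num n = k); last first.
  have -> : M k = setT.
    by apply/seteqP; split=> x //= _ n nid nk; case: none; exists n.
  by split; [exact: openT|move=> O O0 _; rewrite setIT].
have -> : M k = ~` [set x | smap s n x = x].
  apply/seteqP; split=> x /=; first exact.
  by move=> nx m _ mk; rewrite (num_inj m n) ?in_setT// mk nk.
split.
  apply: closed_openC.
  exact: fixed_points_closed (hX e) (@smap_continuous _ s _ _ n).
(* If [O] missed the complement, s(n) would fix all of [O]; a nonzero [f] vanishing off [O] would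
   then violate the criterion. *)
move=> O O0 Oopen; apply: contrapT => disj.
have [f [Af f0 fO]] := bump e O Oopen O0.
apply: f0; apply: (maxA e n) => // g Ag x.
have [Ox|/fO->] := pselect (O x); last by rewrite !mul0r.
suff -> : smap s n x = x by [].
by apply: contrapT => nx; apply: disj; exists x.
Qed.

End FunctionSystem.

Theorem theorem20
    (R : topologicalComPzRingType) (G : category) (s : top_functor G)
    (A : forall e : obj G, unital_subring (top_space s e -> R))
    (A_cont : forall (e : obj G) (f : top_space s e -> R), A e f -> continuous f)
    (A_act : forall (e1 e2 : obj G) (n : mor G e1 e2) (f : top_space s e1 -> R),
       A e1 f -> A e2 (f \o smap s n))
    (A_act1 : forall (e1 e2 : obj G) (n : mor G e1 e2),
       subring_one (A e1) \o smap s n = subring_one (A e2)) :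
  let S := function_system A_act A_act1 in
  let i := topologically_free s in
  let ii := ideal_intersection_property S in
  let iii := maximal_commutative (base_ring S) in
  [/\ (* a *) ii -> iii,
      (* b *) groupoid G -> (ii <-> iii),
      (* c *) integral_domain R ->
        (forall e : obj G, separates (A e)) ->
        (forall (e : obj G) (f : top_space s e -> R), A e f ->
           closed (f @^-1` [set 0])) ->
        i -> iii,
      (* c, sufficient conditions *)
        (closed [set 0 : R] ->
           forall (e : obj G) (f : top_space s e -> R), A e f ->
             closed (f @^-1` [set 0])) /\
        (hausdorff_space R -> closed [set 0 : R])
    & (* d *) integral_domain R ->
        (forall e : obj G, countable [set: mor G e e]) ->
        (forall e : obj G, hausdorff_space (top_space s e)) ->
        (forall e : obj G, baire_space (top_space s e)) ->
        (forall e : obj G, separates (A e)) ->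
        (forall (e : obj G) (U : set (top_space s e)), open U -> U !=set0 ->
           exists f : top_space s e -> R,
             [/\ A e f, f <> 0 & forall x, ~ U x -> f x = 0]) ->
        iii -> i].
Proof.
move=> S i ii iii.
have C : commutative_coeffs S by exact: function_system_commutative.
have aP : ii -> iii by apply: ideal_intersection_maximal.
split=> //.
- by move=> gG; split=> //; apply: maximal_ideal_intersection.
- by move=> domR; apply: topologically_free_maximal.
- split=> [closed0 e f Af|hR].
    by apply: closed_comp closed0 => x _; apply: A_cont Af x.
  exact: accessible_closed_set1 (hausdorff_accessible hR) 0.
- by move=> domR countG hX bX _; apply: maximal_topologically_free.
Qed.
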